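(* Let $r>1$ be an integer and let $p_1=2<p_2<\cdots<p_r$ be distinct primes. Suppose further that $p_t-1\mid p_{t+1}-1$ for all integers $t$ with $0<t<r-1$, and that $p_r\geqslant(p_{r-1}-2)(p_{r-1}-3)$. Then $$p_1^{\frac{p_2-1}{p_1-1}-1}\cdots p_{r-2}^{\frac{p_{r-1}-1}{p_{r-2}-1}-1}\;p_{r-1}^{\left\lfloor\frac{p_r-1}{p_{r-1}-1}\right\rfloor}\;p_r$$ is a primitive covering number. (Here the factors $p_t^{\frac{p_{t+1}-1}{p_t-1}-1}$ run over $1\leqslant t\leqslant r-2$; there are none when $r=2$.)
   Context: For $a\in\mathbb{Z}$ and a positive integer $n$, $a(\mathrm{mod}\ n)=\{a+nx: x\in\mathbb{Z}\}$ is the residue class with modulus $n$. A finite system of residue classes $\{a_i(\mathrm{mod}\ n_i)\}_{i=1}^k$ is a cover of $\mathbb{Z}$ if every integer lies in at least one of the classes $a_i(\mathrm{mod}\ n_i)$. A positive integer $n$ is called a covering number if there is a cover of $\mathbb{Z}$ whose moduli are all distinct, greater than one, and divisors of $n$. A covering number is called a primitive covering number if none of its proper divisors (positive divisors smaller than the number itself) is a covering number. $\lfloor x\rfloor$ denotes the greatest integer not exceeding $x$. *)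

(* Defs.v *)
From HB Require Import structures.
From mathcomp Require Import all_boot all_order all_algebra.

Set Implicit Arguments.
Unset Strict Implicit.
Unset Printing Implicit Defensive.

Import Order.TTheory GRing.Theory Num.Theory.

Definition in_residue_class (a : int) (n : nat) (z : int) : Prop :=
  exists x : int, z = (a + n%:Z * x)%R.

(* A pair [(a, n)] in the sequence stands for the residue class a (mod n). *)
Definition is_cover (s : seq (int * nat)) : Prop :=
  forall z : int, exists2 c, c \in s & in_residue_class c.1 c.2 z.

Definition covering_number (n : nat) : Prop :=
  0 < n /\
  exists s : seq (int * nat),
    [/\ is_cover s,
        uniq [seq c.2 | c <- s],
        (forall c, c \in s -> 1 < c.2)
      & (forall c, c \in s -> c.2 %| n)].

Definition primitive_covering_number (n : nat) : Prop :=
  covering_number n /\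
  (forall d : nat, d %| n -> d < n -> ~ covering_number d).

(* Main.v *)
(* Let tau be the number of divisors, let q be a prime not dividing M, and pass
   from modulus M q^j to M q^(j+1). The only new moduli are the tau(M) numbers
   d q^(j+1) with d | M, and in a fixed class mod M q^j each of them meets exactly
   one of the q subclasses mod M q^(j+1), which can be prescribed. Hence if
   tau(M) < q, no power of q can turn M into a covering number; if tau(M) >= q - 1,
   covering everything but the multiples of M q^j extends to j+1; and if
   tau(M) >= q, the multiples of M can be covered at the level M q.
   Here tau(p_1^e_1 ... p_(s-1)^e_(s-1)) = p_s - 1 for s < r, while
   tau(n / p_r) >= p_r, so n is a covering number. For a proper divisor
   p_1^f_1 ... p_r^f_r all these counts stay below p_s whenever f_s > 0; at s = r
   this is where (p_(r-1) - 2)(p_(r-1) - 3) <= p_r and the primality of p_r enter. *)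
Require Import Defs.
From HB Require Import structures.
From mathcomp Require Import all_boot all_order all_algebra.
From mathcomp Require Import zify ring.
Set Implicit Arguments.
Unset Strict Implicit.

Import Order.TTheory GRing.Theory Num.Theory.

(** * Divisors of [M * p ^ k] *)

Lemma dvdn_mul_pfactor {M p k d : nat} : prime p -> d %| M * p ^ k ->
  exists d1 m, [/\ d1 %| M, m <= k & d = d1 * p ^ m].
Proof.
move=> p_pr; have p_gt0 := prime_gt0 p_pr => d_dvd.
(* Since [p ^ m] is the full gcd of [d] and [p ^ k], the cofactor [d1] is coprime to [p ^ (k - m)],
   and Gauss's lemma makes it divide [M]. *)
have /(dvdn_pfactor _ _ p_pr)[m le_mk def_g] := dvdn_gcdr d (p ^ k).
have /dvdnP[d1 def_d] : p ^ m %| d by rewrite -def_g dvdn_gcdl.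
exists d1, m; split=> //.
have pm_gt0 : 0 < p ^ m by rewrite expn_gt0 p_gt0.
have co : coprime d1 (p ^ (k - m)).
  apply/eqP/eqP; rewrite /coprime -(eqn_pmul2r pm_gt0).
  by rewrite muln_gcdl -expnD subnK // mul1n -def_d def_g.
by rewrite -(Gauss_dvdl M co) -(dvdn_pmul2r pm_gt0) -mulnA -expnD subnK // -def_d.
Qed.

Lemma size_divisors_mul_pfactor M p m : prime p -> 0 < M -> ~~ (p %| M) ->
  size (divisors (M * p ^ m)) = size (divisors M) * m.+1.
Proof.
move=> p_pr M_gt0 pNM.
have p_gt0 := prime_gt0 p_pr; have p_gt1 := prime_gt1 p_pr.
have N_gt0 : 0 < M * p ^ m by rewrite muln_gt0 M_gt0 expn_gt0 p_gt0.
pose s := [seq d * p ^ j | d <- divisors M, j <- iota 0 m.+1].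
rewrite -[in RHS](size_iota 0 m.+1) -(size_allpairs (fun d j => d * p ^ j)).
apply: perm_size; apply: uniq_perm; first exact: divisors_uniq.
  apply: allpairs_uniq; [exact: divisors_uniq | exact: iota_uniq |].
  have logE d j : d \in divisors M -> logn p (d * p ^ j) = j.
    rewrite -dvdn_divisors // => dM; have d_gt0 := dvdn_gt0 M_gt0 dM.
    rewrite lognM ?expn_gt0 ?p_gt0 // pfactorK // lognE p_pr d_gt0 /=.
    by case: ifP => // pd; case/negP: pNM; apply: dvdn_trans dM.
  move=> _ _ /allpairsPdep[d [j [dM _ ->]]] /allpairsPdep[d' [j' [dM' _ ->]]] /= eq_dj.
  have eq_j : j = j' by rewrite -(logE d j dM) -(logE d' j' dM') eq_dj.
  move: eq_dj; rewrite eq_j => /eqP; rewrite eqn_pmul2r ?expn_gt0 ?p_gt0 //.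
  by move=> /eqP ->.
move=> e; rewrite -dvdn_divisors //; apply/idP/allpairsPdep => [|[d [j [dM jm ->]]]].
  case/(dvdn_mul_pfactor p_pr) => d [j [dM le_jm ->]].
  by exists d, j; rewrite -dvdn_divisors // mem_iota.
by rewrite dvdn_mul ?dvdn_exp2l // ?dvdn_divisors //; move: jm; rewrite mem_iota.
Qed.

(** * Covers as a choice of one residue per modulus *)

(* [a d] is the residue chosen for the modulus [d]. *)
Definition hit (a : nat -> int) (N : nat) (z : int) : bool :=
  has (fun d => (1 < d) && (d%:Z %| (z - a d)%R)%Z) (divisors N).

Lemma hitP a N z : 0 < N ->
  reflect (exists d : nat, [/\ 1 < d, d %| N & (d%:Z %| (z - a d)%R)%Z]) (hit a N z).
Proof.
move=> N_gt0; apply: (iffP hasP) => [[d dN /andP[]] | [d [d_gt1 dN dz]]].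
  by exists d; rewrite dvdn_divisors.
by exists d; rewrite -?dvdn_divisors // d_gt1.
Qed.

Lemma covering_numberP N :
  covering_number N <-> 0 < N /\ exists a, forall z, hit a N z.
Proof.
split=> [[N_gt0 [s [s_cover s_uniq s_gt1 s_dvd]]] | [N_gt0 [a a_hit]]]; split=> //.
  (* A modulus absent from [s] gets the default residue 0; such extra classes do no harm. *)
  exists (fun d => (nth (0%Z, 0) s (index d [seq c.2 | c <- s])).1) => z.
  have [c cs [x ->]] := s_cover z.
  apply/hitP => //; exists c.2; split; [exact: s_gt1 | exact: s_dvd |].
  have c_lt : index c s < size s by rewrite index_mem.
  have -> : index c.2 [seq c.2 | c <- s] = index c s.
    by rewrite -{1}(nth_index (0%Z, 0) cs) -(nth_map _ 0) // index_uniq ?size_map.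
  by rewrite nth_index // addrC addKr dvdz_mulr.
exists [seq (a d, d) | d <- divisors N & 1 < d]; split.
- move=> z; have /(hitP _ _ N_gt0)[d [d_gt1 dN /dvdzP[x def_z]]] := a_hit z.
  exists (a d, d); first by apply: map_f; rewrite mem_filter d_gt1 -dvdn_divisors.
  by exists x; rewrite /= mulrC -def_z addrC subrK.
- by rewrite -map_comp map_id filter_uniq ?divisors_uniq.
- by move=> _ /mapP[d + ->]; rewrite mem_filter => /andP[].
- by move=> _ /mapP[d + ->]; rewrite mem_filter -dvdn_divisors // => /andP[].
Qed.

(** * Raising the exponent of one prime by one *)

(** Pigeonhole: if all [p] lifts of the missed [z] were hit, each would need a new modulus
    [d * p ^ j.+1], and no [d] can serve two lifts. *)
Lemma not_hit_layer a M p j z : prime p -> 0 < M -> ~~ (p %| M) ->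
    size (divisors M) < p -> ~~ hit a (M * p ^ j) z ->
  exists z', ~~ hit a (M * p ^ j.+1) z'.
Proof.
move=> p_pr M_gt0 pNM tau_lt z_free; have p_gt0 := prime_gt0 p_pr.
have pos i : 0 < M * p ^ i by rewrite muln_gt0 M_gt0 expn_gt0 p_gt0.
pose lift k : int := (z + (M * p ^ j * k)%N%:Z)%R.
case: (altP (@hasP _ (fun k => ~~ hit a (M * p ^ j.+1) (lift k)) (iota 0 p))).
  by case=> k _ k_free; exists (lift k).
rewrite -all_predC => /allP all_hit.
pose meets k d := ((d * p ^ j.+1)%N%:Z %| (lift k - a (d * p ^ j.+1)%N)%R)%Z.
have meets_ex k : k \in iota 0 p -> exists2 d, d \in divisors M & meets k d.
  move/all_hit; rewrite /= negbK => /(hitP _ _ (pos _))[e [e_gt1 eN e_dvd]].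
  have [d [m [dM le_m def_e]]] := dvdn_mul_pfactor p_pr eN.
  move: le_m; rewrite leq_eqVlt => /predU1P[m_eq | lt_m].
    by exists d; rewrite -?dvdn_divisors // /meets -m_eq -def_e.
  (* A modulus with [m <= j] divides [M * p ^ j], so it cannot tell the lift from [z] and would
     already hit [z]. *)
  case/(hitP _ _ (pos j)): z_free; exists e; split=> //.
    by rewrite def_e dvdn_mul // dvdn_exp2l.
  move: e_dvd; rewrite /lift addrAC rpredDr // dvdzE /=.
  by rewrite dvdn_mulr // def_e dvdn_mul // dvdn_exp2l.
pose f k := find (meets k) (divisors M).
have f_lt k : k \in iota 0 p -> f k < size (divisors M).
  by move=> /meets_ex[d dM d_meets]; rewrite -has_find; apply/hasP; exists d.
have f_inj : {in iota 0 p &, injective f}.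
  move=> k k' kI k'I eq_f.
  have := nth_find 0 (etrans (has_find _ _) (f_lt k kI)).
  have := nth_find 0 (etrans (has_find _ _) (f_lt k' k'I)).
  rewrite -/(f k) -/(f k') -eq_f; set d := nth _ _ _ => dvd_k' dvd_k.
  (* Two lifts sharing [d] agree modulo [p ^ j.+1]; cancelling [p ^ j] and then [M], which is prime
     to [p], leaves [k = k'] modulo [p]. *)
  have: ((p ^ j.+1)%N%:Z %| (lift k - lift k')%R)%Z.
    have -> : (lift k - lift k' = (lift k - a (d * p ^ j.+1)%N) - (lift k' - a (d * p ^ j.+1)%N))%R by ring.
    have dvd_e : ((p ^ j.+1)%N%:Z %| (d * p ^ j.+1)%N%:Z)%Z by rewrite dvdzE dvdn_mull.
    by apply: rpredB; apply: dvdz_trans dvd_e _.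
  have -> : (lift k - lift k' = (p ^ j)%N%:Z * (M%:Z * (k%:Z - k'%:Z)))%R.
    by rewrite /lift !PoszM; ring.
  rewrite expnSr PoszM dvdz_mul2l; last by rewrite -lt0n expn_gt0 p_gt0.
  rewrite Gauss_dvdzr; last by rewrite coprimezE prime_coprime.
  rewrite -eqz_mod_dvd => /eqP; rewrite !modz_nat => /eqP.
  by move: kI k'I; rewrite !mem_iota /= !add0n => kp k'p; rewrite eqz_nat !modn_small // => /eqP.
have : size (map f (iota 0 p)) <= size (iota 0 (size (divisors M))).
  apply: uniq_leq_size; first by rewrite map_inj_in_uniq ?iota_uniq.
  by move=> _ /mapP[k kI ->]; rewrite mem_iota f_lt.
by rewrite size_map !size_iota leqNgt tau_lt.
Qed.

(** Old moduli keep their residues, and the [i]-th divisor of [M], times [p ^ j.+1], is spent on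
    subclass [i + b]. The offset [b] selects the first subclass to be covered. *)
Lemma hit_layer a M p j b : prime p -> 0 < M -> ~~ (p %| M) ->
  exists a', (forall z, hit a (M * p ^ j) z -> hit a' (M * p ^ j.+1) z) /\
    (forall z i, i < size (divisors M) ->
       ((M * p ^ j.+1)%N%:Z %| (z - (M * p ^ j * (i + b))%N%:Z)%R)%Z ->
       hit a' (M * p ^ j.+1) z).
Proof.
move=> p_pr M_gt0 pNM; have p_gt0 := prime_gt0 p_pr.
have pos i : 0 < M * p ^ i by rewrite muln_gt0 M_gt0 expn_gt0 p_gt0.
have pj_gt0 : 0 < p ^ j by rewrite expn_gt0 p_gt0.
exists (fun e => if e %| M * p ^ j then a e
        else Posz (M * p ^ j * (index (e %/ p ^ j.+1) (divisors M) + b))).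
split=> [z /(hitP _ _ (pos j))[d [d_gt1 dN d_dvd]] | z i i_lt z_dvd]; apply/hitP => //.
  by exists d; rewrite dN; split=> //; rewrite (dvdn_trans dN) // dvdn_mul // dvdn_exp2l.
set d := nth 0 (divisors M) i.
have dM : d %| M by rewrite dvdn_divisors // mem_nth.
have d_gt0 : 0 < d := dvdn_gt0 M_gt0 dM.
have eN : d * p ^ j.+1 %| M * p ^ j.+1 by rewrite dvdn_mul.
exists (d * p ^ j.+1); split=> //.
  rewrite (leq_trans (prime_gt1 p_pr)) // expnS mulnCA leq_pmulr //.
  by rewrite muln_gt0 d_gt0.
(* The modulus is new: if it divided [M * p ^ j], then [p] would divide [M]. *)
rewrite ifF; last first.
  apply: contraNF pNM => /(dvdn_trans (dvdn_mull d (dvdnn _))).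
  by rewrite expnS dvdn_pmul2r.
rewrite mulnK ?expn_gt0 ?p_gt0 // index_uniq ?divisors_uniq //.
by apply: dvdz_trans z_dvd; rewrite dvdzE.
Qed.

(** * Non-covers and covers of all but one class, prime by prime *)

(** The missed integer is part of the notion because the induction on the exponent lifts it from
    level to level. *)
Definition misses (N : nat) : Prop := forall a, exists z, ~~ hit a N z.

Lemma misses1 : misses 1.
Proof. by move=> a; exists 0%R. Qed.

Lemma misses_not_covering N : misses N -> ~ covering_number N.
Proof. by move=> mN /covering_numberP[_ [a a_hit]]; have [z /negP] := mN a. Qed.

Lemma misses_mul_pfactor M p m : prime p -> 0 < M -> ~~ (p %| M) ->
  (0 < m -> size (divisors M) < p) -> misses M -> misses (M * p ^ m).
Proof.
move=> p_pr M_gt0 pNM; case: m => [|m]; first by rewrite muln1.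
move=> /(_ isT) tau_lt mM a.
elim: m.+1 => [|j [z z_free]]; first by rewrite muln1; exact: mM.
exact: not_hit_layer z_free.
Qed.

(** The invariant for the primes before the last: [p - 1] new moduli per level are one short of a
    cover, so a single class stays open. *)
Definition hits_nonmultiples (N : nat) : Prop :=
  exists a, forall z, ~~ (N%:Z %| z)%Z -> hit a N z.

Lemma hits_nonmultiples_mul_pfactor M p m : prime p -> 0 < M -> ~~ (p %| M) ->
  p <= (size (divisors M)).+1 -> hits_nonmultiples M -> hits_nonmultiples (M * p ^ m).
Proof.
move=> p_pr M_gt0 pNM tau_ge hM.
elim: m => [|j [a a_hit]]; first by rewrite muln1.
(* Offset 1 skips subclass 0, which consists of the multiples of [M * p ^ j.+1]; only [p - 1]
   subclasses need a divisor. *)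
have [a' [a'_hit a'_layer]] := hit_layer a j 1 p_pr M_gt0 pNM.
exists a' => z zN; have [z_dvd | /a_hit/a'_hit //] := boolP (Posz (M * p ^ j) %| z)%Z.
have p_neq0 : Posz p != 0%R by rewrite -lt0n prime_gt0.
have /dvdzP[x def_z] := z_dvd; move: zN; rewrite def_z => zN.
have x_mod : (x %% p)%Z != 0%R.
  apply: contra zN => /eqP/dvdz_mod0P p_x.
  by rewrite expnSr mulnA (PoszM _ p) mulrC dvdz_mul.
have [c def_c] : exists c : nat, (x %% p)%Z = Posz c.+1.
  have := modz_ge0 x p_neq0; case: (x %% p)%Z x_mod => [[|c]|] //= _ _; by exists c.
have c_lt : c.+1 < p by rewrite -ltz_nat -def_c ltz_pmod // ltz_nat prime_gt0.
apply: (a'_layer _ c); first by rewrite -ltnS (leq_trans c_lt).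
rewrite addn1 expnSr mulnA (PoszM _ p) (PoszM _ c.+1) [(x * _)%R]mulrC -mulrBr.
by rewrite dvdz_mul // -def_c {1}(divz_eq x p) addrK dvdz_mull.
Qed.

Lemma covering_mul_prime M p : prime p -> 0 < M -> ~~ (p %| M) ->
  p <= size (divisors M) -> hits_nonmultiples M -> covering_number (M * p).
Proof.
move=> p_pr M_gt0 pNM tau_ge [a a_hit]; have p_gt0 := prime_gt0 p_pr.
apply/covering_numberP; rewrite muln_gt0 M_gt0 p_gt0; split=> //.
(* With offset 0 all [p] subclasses of the multiples of [M] are covered, subclass 0 included. *)
have [a' []] := hit_layer a 0 0 p_pr M_gt0 pNM.
rewrite expn0 expn1 muln1 => a'_hit a'_layer.
exists a' => z; have [/dvdzP[x ->] | /a_hit/a'_hit //] := boolP (M%:Z %| z)%Z.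
have p_neq0 : Posz p != 0%R by rewrite -lt0n.
have [c def_c] : exists c : nat, (x %% p)%Z = Posz c.
  by have := modz_ge0 x p_neq0; case: (x %% p)%Z => // c _; exists c.
have c_lt : c < p by rewrite -ltz_nat -def_c ltz_pmod // ltz_nat.
apply: (a'_layer _ c); first exact: leq_trans c_lt tau_ge.
by rewrite addn0 !PoszM [(x * _)%R]mulrC -mulrBr dvdz_mul // -def_c {1}(divz_eq x p) addrK dvdz_mull.
Qed.

(** * Products of powers of increasing primes *)

Definition pfactor_prod (p e : nat -> nat) (k : nat) : nat := \prod_(1 <= t < k) p t ^ e t.

Lemma pfactor_prodS p e k : 0 < k -> pfactor_prod p e k.+1 = pfactor_prod p e k * p k ^ e k.
Proof. by move=> k_gt0; rewrite /pfactor_prod big_nat_recr. Qed.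

Lemma pfactor_prod_le1 p e n : n <= 1 -> pfactor_prod p e n = 1.
Proof. by move=> n_le1; rewrite /pfactor_prod big_geq. Qed.

Definition prime_seq (p : nat -> nat) (n : nat) : Prop :=
  (forall t, 0 < t < n -> prime (p t)) /\ (forall s t, 0 < s -> s < t -> t < n -> p s < p t).

Lemma prime_seqS p n : prime_seq p n.+1 -> prime_seq p n.
Proof.
case=> pr inc; split=> [t /andP[t_gt0 tn] | s t s_gt0 st tn].
  by rewrite pr // t_gt0 ltnW.
by apply: inc => //; apply: ltnW.
Qed.

Lemma pfactor_prod_gt0 p e n : prime_seq p n -> 0 < pfactor_prod p e n.
Proof.
case=> pr _; rewrite /pfactor_prod big_nat; apply: prodn_cond_gt0 => t tn.
by rewrite expn_gt0 prime_gt0 ?pr.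
Qed.

Lemma pfactor_prod_ndvd p e n : 0 < n -> prime_seq p n.+1 -> ~~ (p n %| pfactor_prod p e n).
Proof.
move=> n_gt0 [pr inc]; have pn_pr : prime (p n) by rewrite pr // n_gt0 /=.
rewrite -prime_coprime // /pfactor_prod big_nat.
apply: (big_ind (coprime (p n))) => [|x y|t /andP[t_gt0 tn]]; first exact: coprimen1.
  by rewrite coprimeMr => -> ->.
have pt_pr : prime (p t) by rewrite pr // t_gt0 ltnW.
apply: coprimeXr; rewrite prime_coprime // dvdn_prime2 //.
by rewrite gtn_eqF // inc.
Qed.

Lemma size_divisors_pfactor_prod p e n : prime_seq p n ->
  size (divisors (pfactor_prod p e n)) = \prod_(1 <= t < n) (e t).+1.
Proof.
elim: n => [|[|n] IHn] pn; try by rewrite pfactor_prod_le1 // big_geq.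
rewrite pfactor_prodS // size_divisors_mul_pfactor.
- by rewrite IHn ?[RHS]big_nat_recr //; apply: prime_seqS.
- by case: pn => pr _; rewrite pr /=.
- exact/pfactor_prod_gt0/prime_seqS.
- exact: pfactor_prod_ndvd.
Qed.

Lemma hits_nonmultiples_pfactor_prod p e n : prime_seq p n ->
  (forall s, 0 < s < n -> p s <= (\prod_(1 <= t < s) (e t).+1).+1) ->
  hits_nonmultiples (pfactor_prod p e n).
Proof.
elim: n => [|[|n] IHn] pn tau_ge;
  try by rewrite pfactor_prod_le1 //; exists (fun=> 0%R) => z; rewrite dvd1z.
rewrite pfactor_prodS //.
have pn' := prime_seqS pn.
apply: hits_nonmultiples_mul_pfactor.
- by case: pn => pr _; rewrite pr /=.
- exact: pfactor_prod_gt0.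
- exact: pfactor_prod_ndvd.
- by rewrite size_divisors_pfactor_prod // tau_ge /=.
- by apply: IHn => // s /andP[s_gt0 sn]; rewrite tau_ge // s_gt0 ltnW.
Qed.

Lemma misses_pfactor_prod p e n : prime_seq p n ->
  (forall s, 0 < s < n -> 0 < e s -> \prod_(1 <= t < s) (e t).+1 < p s) ->
  misses (pfactor_prod p e n).
Proof.
elim: n => [|[|n] IHn] pn tau_lt;
  try by rewrite pfactor_prod_le1 //; exact: misses1.
rewrite pfactor_prodS //.
have pn' := prime_seqS pn.
apply: misses_mul_pfactor.
- by case: pn => pr _; rewrite pr /=.
- exact: pfactor_prod_gt0.
- exact: pfactor_prod_ndvd.
- by rewrite size_divisors_pfactor_prod //; apply: tau_lt; rewrite /=.
- by apply: IHn => // s /andP[s_gt0 sn]; apply: tau_lt; rewrite s_gt0 ltnW.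
Qed.

Lemma dvdn_pfactor_prod p e n d : prime_seq p n -> d %| pfactor_prod p e n ->
  exists2 f : nat -> nat, (forall t, 0 < t < n -> f t <= e t) & d = pfactor_prod p f n.
Proof.
elim: n d => [|[|n] IHn] d pn;
  try by rewrite pfactor_prod_le1 // dvdn1 => /eqP ->; exists (fun=> 0) => [[]|] //; rewrite pfactor_prod_le1.
rewrite pfactor_prodS // => d_dvd.
have pn_pr : prime (p n.+1) by case: pn => pr _; rewrite pr /=.
have [d1 [m [d1_dvd le_m ->]]] := dvdn_mul_pfactor pn_pr d_dvd.
have [f f_le ->] := IHn d1 (prime_seqS pn) d1_dvd.
exists (fun t => if t == n.+1 then m else f t) => [t /andP[t_gt0 tn]|].
  case: eqP => [-> // | /eqP t_neq]; apply: f_le.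
  by rewrite t_gt0 ltn_neqAle t_neq.
rewrite [RHS]pfactor_prodS //= eqxx; congr (_ * _).
by apply: eq_big_nat => t /andP[_ tn]; rewrite ltn_eqF.
Qed.

(** * Inequalities for the divisor counts *)

Lemma leq_prod_nat m n (F G : nat -> nat) : (forall t, m <= t < n -> F t <= G t) ->
  \prod_(m <= t < n) F t <= \prod_(m <= t < n) G t.
Proof. by move=> le_FG; rewrite !big_nat; apply: leq_prod. Qed.

Lemma ltn_prod_nat m n s (F G : nat -> nat) : m <= s < n -> F s < G s ->
    (forall t, m <= t < n -> F t <= G t) -> (forall t, m <= t < n -> 0 < G t) ->
  \prod_(m <= t < n) F t < \prod_(m <= t < n) G t.
Proof.
move=> /andP[ms sn] lt_FG le_FG G_gt0.
rewrite 2?(@big_cat_nat _ _ _ s m n) ?(ltnW sn) //= 2?(@big_ltn _ _ _ s n) //.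
have gt0 i j : m <= i -> j <= n -> 0 < \prod_(i <= t < j) G t.
  move=> mi jn; rewrite big_nat; apply: prodn_cond_gt0 => t /andP[it tj].
  by rewrite G_gt0 // (leq_trans mi it) (leq_trans tj).
have le1 : \prod_(m <= t < s) F t <= \prod_(m <= t < s) G t.
  apply: leq_prod_nat => t /andP[mt ts]; rewrite le_FG // mt; exact: ltn_trans sn.
have le2 : \prod_(s.+1 <= t < n) F t <= \prod_(s.+1 <= t < n) G t.
  apply: leq_prod_nat => t /andP[st tn]; rewrite le_FG // tn andbT.
  exact: leq_trans ms (ltnW st).
apply: leq_ltn_trans (leq_mul le1 (leq_mul (leqnn _) le2)) _.
by rewrite ltn_pmul2l ?gt0 ?(ltnW sn) // ltn_pmul2r ?gt0 // (leq_trans ms).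
Qed.

(* Writing P - 1 = m (q - 1) + c, the claim amounts to q - 2 <= m + c; the hypotheses
   leave only P = (q - 2)^2 and P = (q - 2)(q - 3) as exceptions, which are composite. *)
Lemma last_layer_bound q P : 2 < q -> q < P -> prime P -> (q - 2) * (q - 3) <= P ->
  (q - 2) * ((P - 1) %/ (q - 1)).+1 < P.
Proof.
move=> q_gt2 lt_qP P_pr P_ge.
set m := (P - 1) %/ (q - 1); set c := (P - 1) %% (q - 1).
have def_P : P - 1 = m * (q - 1) + c := divn_eq _ _.
have c_lt : c < q - 1 by rewrite ltn_mod; lia.
have not_prod x y : 1 < x -> 1 < y -> P <> x * y.
  move=> x_gt1 y_gt1 eq_P; case/primeP: P_pr => _ /(_ x).
  rewrite eq_P dvdn_mulr // => /(_ isT)/orP[/eqP|/eqP]; nia.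
suff : q - 2 <= m + c by nia.
rewrite leqNgt; apply/negP => mc_lt.
clearbody m c.
(* The lower bound on [P] forces [m >= q - 4], and [m + c <= q - 3] then leaves
   [(m, c) = (q - 3, 0)] or [(q - 4, 1)]. The value [q = 4] is set apart because there [q - 3 = 1]
   is no proper factor. *)
have m_eq : q <= m + 4 by nia.
have q_gt3 : 3 < q by nia.
have [q4 | q_gt4] := leqP q 4; first by apply: (not_prod 2 2) => //; nia.
have [m_eq3 | m_neq3] := eqVneq m (q - 3).
  by apply: (not_prod (q - 2) (q - 2)); nia.
by apply: (not_prod (q - 2) (q - 3)); nia.
Qed.

Theorem theorem1p3 (r : nat) (p : nat -> nat)
  (r_gt1 : 1 < r)
  (p_prime : forall t : nat, 1 <= t <= r -> prime (p t))
  (p1_eq2 : p 1 = 2)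
  (p_increasing : forall t : nat, 1 <= t < r -> p t < p t.+1)
  (p_dvd : forall t : nat, 0 < t < r - 1 -> p t - 1 %| p t.+1 - 1)
  (pr_ge : (p (r - 1) - 2) * (p (r - 1) - 3) <= p r) :
  primitive_covering_number
    ((\prod_(1 <= t < r - 1) p t ^ ((p t.+1 - 1) %/ (p t - 1) - 1))
     * p (r - 1) ^ ((p r - 1) %/ (p (r - 1) - 1))
     * p r).
Proof.
(* From here on [k = r - 1], so the last two primes are [p k] and [p k.+1]. *)
case: r r_gt1 p_prime p_increasing p_dvd pr_ge => // k k_gt0 p_prime p_increasing.
rewrite !subn1 /= => p_dvd pr_ge; rewrite -!subn1.
have {}k_gt0 : 0 < k by [].
set m := (p k.+1 - 1) %/ (p k - 1).
pose e t := if t < k then (p t.+1 - 1) %/ (p t - 1) - 1 else if t == k then m else 1.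
have e_k : e k = m by rewrite /e ltnn eqxx.
have e_k1 : e k.+1 = 1 by rewrite /e ltnNge leqnSn /= gtn_eqF.
have p_gt1 t : 0 < t <= k.+1 -> 1 < p t by move=> t_in; rewrite prime_gt1 ?p_prime.
have p_mono s t : 0 < s -> s < t -> t < k.+2 -> p s < p t.
  move=> s_gt0; elim: t => // t IHt; rewrite ltnS leq_eqVlt => /predU1P[s_eq | st] tk.
    by rewrite s_eq; apply: p_increasing; lia.
  by apply: ltn_trans (IHt st (ltnW tk)) (p_increasing _ _); lia.
have p_seq n : n <= k.+2 -> prime_seq p n.
  move=> le_n; split=> [t t_in | s t s_gt0 st tn]; first by rewrite p_prime //; lia.
  by apply: p_mono => //; lia.
have -> : (\prod_(1 <= t < k) p t ^ ((p t.+1 - 1) %/ (p t - 1) - 1)) * p k ^ m * p k.+1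
          = pfactor_prod p e k.+2.
  rewrite !pfactor_prodS // e_k e_k1 expn1; congr (_ * _ * _).
  by apply: eq_big_nat => t /andP[_ tk]; rewrite /e tk.
have e_succ t : 0 < t < k -> (e t).+1 * (p t - 1) = p t.+1 - 1.
  move=> t_in; have tk : t < k by case/andP: t_in.
  have lt_p : p t < p t.+1 by apply: p_mono; lia.
  have := p_gt1 t; rewrite /e tk => /(_ ltac:(lia)) pt_gt1.
  have quot_gt0 : 0 < (p t.+1 - 1) %/ (p t - 1) by rewrite divn_gt0; lia.
  by rewrite -[in RHS](divnK (p_dvd t t_in)); congr (_ * _); lia.
(* By [e_succ] the product telescopes, starting from [p 1 - 1 = 1]. *)
have tau_eq s : 0 < s <= k -> \prod_(1 <= t < s) (e t).+1 = p s - 1.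
  elim: s => [|[|s] IHs] // s_in; first by rewrite big_geq // p1_eq2.
  rewrite big_nat_recr //= IHs; last by lia.
  by rewrite mulnC e_succ //; lia.
have tau_last : \prod_(1 <= t < k.+1) (e t).+1 = (p k - 1) * m.+1.
  by rewrite big_nat_recr //= tau_eq ?k_gt0 //= e_k.
have pk_gt1 : 1 < p k by apply: p_gt1; lia.
have pk_lt : p k < p k.+1 by apply: p_mono.
have m_le : m * (p k - 1) <= p k.+1 - 1 := leq_trunc_div _ _.
have m_ge : p k.+1 - 1 < m.+1 * (p k - 1) by rewrite ltn_ceil //; lia.
split.
  rewrite pfactor_prodS // e_k1 expn1; apply: covering_mul_prime.
  - by rewrite p_prime //= leqnn.
  - exact/pfactor_prod_gt0/p_seq.
  - exact/pfactor_prod_ndvd/p_seq.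
  (* The count [(p k - 1) * m.+1] exceeds [p k.+1 - 1] because [m] is the floor of the quotient. *)
  - by rewrite size_divisors_pfactor_prod; [rewrite tau_last; nia | exact: p_seq].
  - apply: hits_nonmultiples_pfactor_prod => [|s s_in]; first exact: p_seq.
    by rewrite tau_eq; [lia | lia].
move=> d d_dvd d_lt; apply: misses_not_covering.
have [f f_le def_d] := dvdn_pfactor_prod (p_seq _ (leqnn _)) d_dvd.
rewrite def_d; apply: misses_pfactor_prod => [|s s_in fs_gt0]; first exact: p_seq.
have f_le_prod n : n <= k.+2 -> \prod_(1 <= t < n) (f t).+1 <= \prod_(1 <= t < n) (e t).+1.
  by move=> le_n; apply: leq_prod_nat => t t_in; rewrite ltnS f_le //; lia.
have [le_sk | lt_ks] := leqP s k.
  have ps_gt1 : 1 < p s by apply: p_gt1; lia.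
  apply: leq_ltn_trans (f_le_prod s _) _; first by lia.
  by rewrite tau_eq; lia.
have {lt_ks s_in} s_eq : s = k.+1 by lia.
rewrite s_eq in fs_gt0 *.
have f_k1 : f k.+1 = 1 by have := f_le k.+1; rewrite e_k1; lia.
(* The last prime keeps its exponent 1, so a proper divisor must lose at some earlier prime. *)
have [u u_in fu_lt] : exists2 u, 0 < u <= k & f u < e u.
  case: (altP (@hasP _ (fun u => f u < e u) (index_iota 1 k.+1))) => [[u]|].
    by rewrite mem_index_iota; exists u.
  rewrite -all_predC => /allP f_ge; move: d_lt; rewrite def_d ltnNge.
  rewrite /pfactor_prod leq_prod_nat // => t t_in.
  have [-> | t_neq] := eqVneq t k.+1; first by rewrite f_k1 e_k1.
  have pt_gt0 : 0 < p t by apply: ltnW; apply: p_gt1; lia.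
  rewrite leq_pexp2l // leqNgt; apply: f_ge; rewrite mem_index_iota; lia.
rewrite big_nat_recr //=.
(* A loss at [k] bounds the count by [(p k - 1) * m], which is at most [p k.+1 - 1]. *)
have [u_eq | u_neq] := eqVneq u k.
  have := f_le_prod k; rewrite tau_eq ?k_gt0 //= => /(_ ltac:(lia)) f_prod_le.
  rewrite u_eq e_k in fu_lt *; apply: leq_ltn_trans (leq_mul f_prod_le fu_lt) _.
  by rewrite mulnC; apply: leq_ltn_trans m_le _; lia.
(* A loss before [k] only brings the count down to [(p k - 2) * m.+1], the quantity bounded by
   [last_layer_bound]. *)
have f_prod_lt : \prod_(1 <= t < k) (f t).+1 < p k - 1.
  rewrite -tau_eq ?k_gt0 //=; apply: (@ltn_prod_nat _ _ u) => //; first by lia.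
  by move=> t t_in; rewrite ltnS f_le //; lia.
have fk_le : f k <= m by rewrite -e_k f_le //; lia.
have pk_gt2 : 2 < p k by rewrite -p1_eq2; apply: p_mono; lia.
have := last_layer_bound pk_gt2 pk_lt (p_prime k.+1 _) pr_ge.
rewrite /= leqnn -/m => /(_ isT); apply: leq_ltn_trans.
by apply: leq_mul => //; lia.
Qed.
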